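(* Let $k$ be a positive integer. Any graph containing no cycles of length four with minimum degree at least $k+1$ contains $k$ pairwise vertex-disjoint cycles.
   Context: All graphs are finite and simple, with non-empty vertex set. ''Containing no cycles of length four'' means that the graph has no (not necessarily induced) subgraph isomorphic to $C_4$. *)

(* Defs.v *)
(* A simple graph is a symmetric irreflexive adjacency
   relation [e] on a finite type [T] of vertices. *)
From mathcomp Require Import all_boot.

Set Implicit Arguments.
Unset Strict Implicit.
Unset Printing Implicit Defensive.

Definition degree (T : finType) (e : rel T) (x : T) : nat :=
  #|[set y | e x y]|.

(* The neutral value #|T| exceeds every degree of a simple graph, so it is
   never attained when T is non-empty. *)
Definition min_degree (T : finType) (e : rel T) : nat :=
  \big[minn/#|T|]_(x : T) degree e x.

(* A cycle is given by the cyclic sequence of its distinct vertices.  The size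
   bound excludes the closed walks [::] and [:: x; y], which [ucycle] accepts
   but which are not cycles of a simple graph. *)
Definition graph_cycle (T : finType) (e : rel T) (c : seq T) : Prop :=
  ucycle e c /\ 2 < size c.

(* Chords are allowed: subgraphs need not be induced. *)
Definition no_cycle_of_length (T : finType) (e : rel T) (n : nat) : Prop :=
  forall c : seq T, graph_cycle e c -> size c <> n.

Definition has_disjoint_cycles (T : finType) (e : rel T) (k : nat) : Prop :=
  exists C : 'I_k -> seq T,
    (forall i, graph_cycle e (C i)) /\
    (forall i j, i != j -> [disjoint C i & C j]).

(* Main.v *)
Require Import Defs.
From mathcomp Require Import all_boot.
From mathcomp Require Import zify.

(** In a graph without 4-cycles, a vertex outside a shortest cycle [c] has at
    most one neighbour on [c].  Indeed two neighbours [x], [y] of [z] on [c]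
    split [c] into two arcs, and each arc closes up through [z] to a cycle;
    since neither is shorter than [c], each arc has at most one interior
    vertex, so [c] or one of the two new cycles has length four
    ([shortest_cycle_neighbours]).  Deleting a shortest cycle therefore lowers
    the minimum degree by at most one, and one can delete cycles greedily: by
    induction on [k], minimum degree [k + 1] yields [k] disjoint cycles
    ([disjoint_cycles_within]).

    Two points complete the induction.  A non-empty graph of minimum degree two
    has a cycle ([cycle_exists]).  The graph left after the deletion is
    non-empty as long as another cycle is wanted, since a shortest cycle has no
    chord ([shortest_cycle_chordless]), so that its vertices, of degree at
    least three, have neighbours outside it.

    Instead of passing to induced subgraphs on new vertex types, the argument
    keeps the ambient graph and restricts to a set [A] of remaining
    vertices. *)

Section DisjointCycles.

Variables (T : finType) (e : rel T).
Hypotheses (e_sym : symmetric e) (e_irr : irreflexive e).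

Implicit Types (A B : {set T}) (c p : seq T) (x y z : T).

Definition neighbours_in A x : {set T} := [set y in A | e x y].

Definition cycle_in A c : Prop := graph_cycle e c /\ {subset c <= A}.

Definition shortest_cycle_in A c : Prop :=
  cycle_in A c /\ forall c', cycle_in A c' -> size c <= size c'.

Lemma cycle_in_close A x p y :
  {subset x :: rcons p y <= A} -> path e x (rcons p y) ->
  uniq (x :: rcons p y) -> e y x -> p != [::] ->
  cycle_in A (x :: rcons p y).
Proof.
move=> sub pth unq eyx pn0; split=> //; split.
  by apply/andP; split=> //; rewrite /cycle rcons_path pth last_rcons.
by case: p pn0 {sub pth unq} => // a p _; rewrite /= size_rcons.
Qed.

Lemma cycle_in_rot A c n : cycle_in A c -> cycle_in A (rot n c).
Proof.
case=> [[/andP[cyc unq] sz] sub]; split; last by move=> y; rewrite mem_rot; apply: sub.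
by split; rewrite ?size_rot // /ucycle /ucycleb rot_cycle rot_uniq cyc unq.
Qed.

Lemma shortest_cycle_in_rot A c n :
  shortest_cycle_in A c -> shortest_cycle_in A (rot n c).
Proof.
by case=> cA cmin; split; [apply: cycle_in_rot | rewrite size_rot].
Qed.

(** The first vertex of a path has a neighbour other than the second one.  If
    that neighbour lies on the path it closes a cycle, and otherwise it extends
    the path, which can happen only finitely often: [n] bounds the number of
    extensions left. *)
Lemma cycle_from_path A n x p :
  (forall z, z \in A -> 1 < #|neighbours_in A z|) ->
  {subset x :: p <= A} -> path e x p -> uniq (x :: p) ->
  #|A| < n + size (x :: p) -> exists c, cycle_in A c.
Proof.
move=> degA; elim: n x p => [|n IHn] x p sub pth unq szn.
  have := subset_leq_card (introT subsetP sub).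
  by rewrite (card_uniqP unq) leqNgt szn.
have xA : x \in A by apply: sub; rewrite mem_head.
have [y yN yp] : exists2 y, y \in neighbours_in A x & y != head x p.
  have: 0 < #|neighbours_in A x :\ head x p|.
    by have := degA x xA; rewrite (cardsD1 (head x p)); case: (_ \in _); lia.
  by case/card_gt0P=> y /setD1P[yp yN]; exists y.
move: yN; rewrite inE => /andP[yA exy].
have yx : y != x by apply: contraTneq exy => ->; rewrite e_irr.
have [yinp|ynp] := boolP (y \in p).
  case/splitPr: yinp => p1 p2 in sub pth unq yp {IHn szn} *.
  exists (x :: rcons p1 y); apply: cycle_in_close.
  - move=> z zc; apply: sub; move: zc.
    by rewrite -cat_rcons !inE mem_cat => /orP[->|->]; rewrite ?orbT.
  - by move: pth; rewrite -cat_rcons cat_path => /andP[].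
  - by move: unq; rewrite -cat_rcons -cat_cons cat_uniq => /andP[].
  - by rewrite e_sym.
  - by apply: contraNneq yp => ->.
apply: (IHn y (x :: p)).
- by move=> z; rewrite inE => /orP[/eqP->|/sub].
- by rewrite /= e_sym exy.
- by rewrite cons_uniq unq inE negb_or yx ynp.
- by move: szn => /=; rewrite !addnS addSn.
Qed.

Lemma cycle_exists A :
  A != set0 -> (forall z, z \in A -> 1 < #|neighbours_in A z|) ->
  exists c, cycle_in A c.
Proof.
case/set0Pn=> x xA degA; apply: (@cycle_from_path A #|A| x [::]) => //.
- by move=> z; rewrite inE => /eqP->.
- by rewrite addn1.
Qed.

Lemma shortest_cycle_exists A :
  (exists c, cycle_in A c) -> exists c, shortest_cycle_in A c.
Proof.
(* Tuples of a given length form a finite type, which makes the existence of a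
   cycle of that length decidable. *)
pose P n := [exists t : n.-tuple T, [&& ucycleb e t, 2 < n & all (mem A) t]].
have inP c : cycle_in A c -> P (size c).
  case=> [[ucyc sz] sub]; apply/existsP; exists (in_tuple c).
  by apply/and3P; split=> //; apply/allP.
case=> c0 /inP P0; have exP : exists n, P n by exists (size c0).
case: (ex_minnP exP) => n /existsP[t /and3P[ucyc sz /allP sub]] nmin.
exists t; split; first by split=> //; split=> //; rewrite size_tuple.
by move=> c' /inP; rewrite size_tuple; apply: nmin.
Qed.

(** A chord from [x] to an interior vertex of the rest [p] of the cycle would
    cut off a shorter cycle. *)
Lemma shortest_cycle_chordless A x p y :
  shortest_cycle_in A (x :: p) -> y \in p -> e x y ->
  y \in [set head x p; last x p].
Proof.
case=> [[[/andP[cyc unq] _] sub] cmin] yp exy.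
case/splitPr: yp => p1 p2 in cyc unq sub cmin *.
rewrite !inE last_cat /=.
case: (altP (p1 =P [::])) => [->|p1n0]; first by rewrite eqxx.
case: p2 => [|a p2] in cyc unq sub cmin *; first by rewrite eqxx orbT.
suff /cmin : cycle_in A (x :: rcons p1 y).
  by rewrite /= size_cat size_rcons /=; lia.
move: cyc unq sub; rewrite -cat_rcons => cyc unq sub.
apply: cycle_in_close => //.
- by move=> z zc; apply: sub; rewrite -cat_cons mem_cat zc.
- by move: cyc; rewrite /cycle rcons_cat cat_path => /andP[].
- by move: unq; rewrite -cat_cons cat_uniq => /andP[].
- by rewrite e_sym.
Qed.

Lemma shortest_cycle_neighbours A c z :
  no_cycle_of_length e 4 -> shortest_cycle_in A c ->
  z \in A -> z \notin c -> #|neighbours_in [set u in c] z| <= 1.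
Proof.
move=> hC4 cmin zA znc; apply/card_le1_eqP => x y.
rewrite !inE => /andP[xc ezx] /andP[yc ezy].
apply/eqP/negPn/negP => yx.
case/rot_to: xc => n p def_c.
have := shortest_cycle_in_rot _ _ n cmin; rewrite def_c => {}cmin.
have yp : y \in p by move: yc; rewrite -(mem_rot n) def_c inE (negPf yx).
have {znc} znp : z \notin x :: p by rewrite -def_c mem_rot.
move: cmin => [cA {}cmin].
case/splitPr: yp => p1 p2 in cA cmin znp {def_c} *.
have [[/andP[cyc unq] sz] sub] := cA.
(* Each arc from [x] to [y], in either direction, closes up through [z]. *)
have c1A : cycle_in A (z :: rcons (x :: p1) y).
  move: cyc unq sub znp; rewrite -cat_rcons => cyc unq sub znp.
  apply: cycle_in_close => //.
  - move=> u; rewrite inE => /orP[/eqP->//|uc].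
    by apply: sub; rewrite -cat_cons mem_cat uc.
  - by move: cyc; rewrite /cycle rcons_cat cat_path /= ezx => /andP[].
  - have unq1 : uniq (x :: rcons p1 y).
      by move: unq; rewrite -cat_cons cat_uniq => /andP[].
    rewrite rcons_cons cons_uniq unq1 andbT.
    by move: znp; rewrite -cat_cons mem_cat negb_or => /andP[].
  - by rewrite e_sym.
have c2A : cycle_in A (z :: rcons (y :: p2) x).
  have sub2 : {subset rcons (y :: p2) x <= x :: p1 ++ y :: p2}.
    move=> u; rewrite mem_rcons [in X in _ -> X]inE mem_cat inE.
    by case/orP=> [->//|->]; rewrite !orbT.
  apply: cycle_in_close => //.
  - by move=> u; rewrite inE => /orP[/eqP->//|/sub2/sub].
  - by move: cyc; rewrite /cycle rcons_cat cat_path /= ezy => /and3P[].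
  - rewrite cons_uniq (contra (sub2 z) znp) rcons_uniq.
    move: unq; rewrite cons_uniq cat_uniq mem_cat negb_or.
    by case/andP=> /andP[_ ->] /and3P[_ _ ->].
  - by rewrite e_sym.
have s := hC4 _ cA.1; have s1 := hC4 _ c1A.1; have s2 := hC4 _ c2A.1.
move: sz s s1 s2 (cmin _ c1A) (cmin _ c2A).
by rewrite /= !size_rcons size_cat /=; lia.
Qed.

(** The cycles are indexed by all natural numbers, of which only the first [k]
    matter, so that a new cycle is added at the front by a mere shift. *)
Lemma disjoint_cycles_within k A :
  no_cycle_of_length e 4 -> A != set0 ->
  (forall x, x \in A -> k < #|neighbours_in A x|) ->
  exists C : nat -> seq T,
    (forall i, i < k -> cycle_in A (C i)) /\
    (forall i j, i < k -> j < k -> i != j -> [disjoint C i & C j]).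
Proof.
move=> hC4; elim: k A => [|k IHk] A An0 degA; first by exists (fun=> [::]).
have [c cmin] : exists c, shortest_cycle_in A c.
  apply/shortest_cycle_exists/cycle_exists => // z zA.
  exact: leq_trans (degA z zA).
have [[[ucyc sz] sub] _] := cmin.
pose B := A :\: [set u in c].
have splitN x : neighbours_in A x = neighbours_in B x :|: neighbours_in [set u in c] x.
  apply/setP=> y; rewrite !inE; have := sub y.
  by case: (y \in c) => [->|_]; rewrite // orbF.
have degB x : x \in B -> k < #|neighbours_in B x|.
  rewrite !inE => /andP[xnc xA].
  have := leq_trans (degA x xA); rewrite splitN => /(_ _ (leq_card_setU _ _)).
  have := shortest_cycle_neighbours _ _ _ hC4 cmin xA xnc; lia.
have [C [CB Cdisj]] : exists C : nat -> seq T,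
    (forall i, i < k -> cycle_in B (C i)) /\
    (forall i j, i < k -> j < k -> i != j -> [disjoint C i & C j]).
  case: (posnP k) => [->|k_gt0]; first by exists (fun=> [::]).
  apply: (IHk B) => //.
  (* If [B] were empty, every neighbour of the head of [c] would lie on [c]. *)
  apply/negP => /eqP B0; case def_c: c sz => [//|x p] _.
  have xA : x \in A by apply: sub; rewrite def_c mem_head.
  have := degA x xA; suff: #|neighbours_in A x| <= 2 by lia.
  apply: (@leq_trans #|[set head x p; last x p]|).
    apply/subset_leq_card/subsetP => y; rewrite splitN B0 !inE def_c /=.
    rewrite inE => /andP[yc exy]; rewrite -in_set2.
    apply: (shortest_cycle_chordless A) => //; first by rewrite -def_c.
    by case/orP: yc => // /eqP yx; rewrite yx e_irr in exy.
  by rewrite cards2; case: (_ != _).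
have disjc i : i < k -> [disjoint c & C i].
  move=> /CB[_ subi]; rewrite disjoint_sym; apply/pred0P => y /=.
  by apply/negP => /andP[/subi]; rewrite !inE => /andP[/negPf->].
exists (fun i => if i is i'.+1 then C i' else c); split.
  case=> [_|i /CB[cyci subi]]; first by split.
  by split=> // y /subi; rewrite inE => /andP[].
case=> [|i] [|j] // ik jk ij; first exact: disjc.
  by rewrite disjoint_sym; apply: disjc.
exact: Cdisj.
Qed.

Lemma min_degree_le x : min_degree e <= degree e x.
Proof.
rewrite /min_degree; have: x \in index_enum T by rewrite mem_index_enum.
elim: (index_enum T) => // y s IHs; rewrite inE big_cons geq_min.
by case/orP=> [/eqP->|/IHs->]; rewrite ?leqnn ?orbT.
Qed.

End DisjointCycles.

Theorem corollary5 (k : nat) (hk : 0 < k)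
    (T : finType) (hT : 0 < #|T|)
    (e : rel T) (e_sym : symmetric e) (e_irr : irreflexive e)
    (hC4 : no_cycle_of_length e 4)
    (hdeg : k + 1 <= min_degree e) :
  has_disjoint_cycles e k.
Proof.
have [||C [Ccyc Cdisj]] := disjoint_cycles_within _ _ e_sym e_irr k [set: T] hC4.
- by rewrite -card_gt0 cardsT.
- move=> x _; have -> : neighbours_in T e [set: T] x = [set y | e x y].
    by apply/setP=> y; rewrite !inE.
  by rewrite -addn1; apply: leq_trans hdeg (min_degree_le _ _ x).
exists (fun i : 'I_k => C i); split=> [i|i j ij].
  by have [] := Ccyc i (ltn_ord i).
exact: Cdisj.
Qed.
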